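(* Let $\Omega\subseteq\mathbb{R}^n$ be closed and convex and let $f:\Omega\to\mathbb{R}$ be continuously differentiable. Assume that $f$ is convex on $\Omega$ and that the solution set $X^*$ of the problem $\min_{x\in\Omega} f(x)$ is not empty. Let $\{x^{(k)}\}_{k\in\mathbb{N}}$ be a sequence generated by the scaled gradient projection (SGP) method (described in the context), where $D_k\in\mathcal{M}_{\mu_k}$ for all $k$ and $\{\mu_k\}_{k\in\mathbb{N}}$ satisfies $$\mu_k^2 = 1+\zeta_k,\qquad \zeta_k\geq 0,\qquad \sum_{k=0}^\infty \zeta_k<\infty .$$ Then the sequence $\{x^{(k)}\}_{k\in\mathbb{N}}$ converges to a solution of $\min_{x\in\Omega} f(x)$, i.e. to a point of $X^*$.
   Context: Notation: for a symmetric positive definite matrix $D$, $\|x\|_D=(x^TDx)^{1/2}$. For $\mu\geq 1$, $\mathcal{M}_\mu$ denotes the set of symmetric positive definite $n\times n$ matrices with all eigenvalues in $[1/\mu,\mu]$. A continuously differentiable $f:\Omega\to\mathbb{R}$ is convex if $f(y)\geq f(x)+\nabla f(x)^T(y-x)$ for all $x,y\in\Omega$. Armijo linesearch: given parameters $\delta,\beta\in(0,1)$, a point $x^{(k)}\in\Omega$ and a direction $d^{(k)}$, start with $\lambda^{(k)}=1$ and, as long as the inequality $$f(x^{(k)}+\lambda^{(k)}d^{(k)})\leq f(x^{(k)})+\beta\lambda^{(k)}\nabla f(x^{(k)})^Td^{(k)}$$ is not satisfied, replace $\lambda^{(k)}$ by $\delta\lambda^{(k)}$; the output is the first $\lambda^{(k)}$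 satisfying it. SGP method: choose $0<\alpha_{\min}\leq\alpha_{\max}$, $\mu\geq 1$, $\delta,\beta\in(0,1)$, $x^{(0)}\in\Omega$. For $k=0,1,2,\dots$: 1. choose $\alpha_k\in[\alpha_{\min},\alpha_{\max}]$; 2. choose $\mu_k\leq\mu$ (with $\mu_k\ge 1$) and a matrix $D_k\in\mathcal{M}_{\mu_k}$; 3. compute $y^{(k)}$, the projection onto $\Omega$ of $x^{(k)}-\alpha_kD_k\nabla f(x^{(k)})$ in the norm $\|\cdot\|_{D_k^{-1}}$, i.e. $$y^{(k)}=\arg\min_{x\in\Omega}\ \nabla f(x^{(k)})^T(x-x^{(k)})+\frac{1}{2\alpha_k}(x-x^{(k)})^TD_k^{-1}(x-x^{(k)});$$ 4. set $d^{(k)}=y^{(k)}-x^{(k)}$; 5. compute $\lambda^{(k)}$ with the Armijo linesearch (parameters $\delta,\beta$); 6. set $x^{(k+1)}=x^{(k)}+\lambda^{(k)}d^{(k)}$. *)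

(* Defs.v *)
From HB Require Import structures.
From mathcomp Require Import all_boot all_order all_algebra.
From mathcomp Require Import all_classical all_reals all_analysis.
Import Order.TTheory GRing.Theory Num.Theory.
Import numFieldNormedType.Exports.

Set Implicit Arguments.
Unset Strict Implicit.
Unset Printing Implicit Defensive.

Local Open Scope classical_set_scope.
Local Open Scope ring_scope.

Section Definitions.
Variables (R : realType) (n : nat).
Implicit Types (x y d u v : 'cV[R]_n) (D : 'M[R]_n).

Definition dotp u v : R := (u^T *m v) 0 0.

Definition wnorm D x : R := Num.sqrt (dotp x (D *m x)).

Definition posdefmx D : Prop :=
  D^T = D /\ forall x, x != 0 -> 0 < dotp x (D *m x).

(* [eigenvalue] refers to row eigenvectors, which is immaterial as D is
   symmetric; the eigenvalues of such a D all lie in R. *)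
Definition Mset (mu : R) : set 'M[R]_n :=
  [set D | posdefmx D /\
     forall a : R, eigenvalue D a -> mu^-1 <= a <= mu].

(* A function Omega -> R is represented by a total function of which only the
   values on Omega matter; the same holds for its gradient. Differentiability
   is therefore relative to Omega: it makes sense at boundary points and for
   sets Omega with empty interior, and it coincides with the usual notion at
   interior points. The norm `| _ | is the sup norm of 'cV_n. *)
Definition is_gradient_on (Omega : set 'cV[R]_n) (f : 'cV[R]_n -> R)
    (g : 'cV[R]_n -> 'cV[R]_n) : Prop :=
  forall x, Omega x -> forall e : R, 0 < e ->
    \forall y \near x, Omega y ->
      `|f y - f x - dotp (g x) (y - x)| <= e * `|y - x|.

Definition continuously_differentiable_on (Omega : set 'cV[R]_n)
    (f : 'cV[R]_n -> R) (g : 'cV[R]_n -> 'cV[R]_n) : Prop :=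
  is_gradient_on Omega f g /\ {within Omega, continuous g}.

Definition convex_on (Omega : set 'cV[R]_n) (f : 'cV[R]_n -> R)
    (g : 'cV[R]_n -> 'cV[R]_n) : Prop :=
  forall x y, Omega x -> Omega y -> f x + dotp (g x) (y - x) <= f y.

Definition solutions (Omega : set 'cV[R]_n) (f : 'cV[R]_n -> R) :
    set 'cV[R]_n :=
  [set x | Omega x /\ forall y, Omega y -> f x <= f y].

Definition is_projection D (Omega : set 'cV[R]_n) z y : Prop :=
  Omega y /\ forall x, Omega x -> wnorm D (y - z) <= wnorm D (x - z).

Definition armijo (f : 'cV[R]_n -> R) (g : 'cV[R]_n -> 'cV[R]_n)
    (beta : R) x d (lam : R) : Prop :=
  f (x + lam *: d) <= f x + beta * lam * dotp (g x) d.

Definition armijo_linesearch (f : 'cV[R]_n -> R) (g : 'cV[R]_n -> 'cV[R]_n)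
    (delta beta : R) x d (lam : R) : Prop :=
  exists m : nat, [/\ lam = delta ^+ m, armijo f g beta x d lam &
    forall j : nat, (j < m)%N -> ~ armijo f g beta x d (delta ^+ j)].

Record sgp (Omega : set 'cV[R]_n) (f : 'cV[R]_n -> R)
    (g : 'cV[R]_n -> 'cV[R]_n) (alpha_min alpha_max mu delta beta : R)
    (alpha muk lam : nat -> R) (D : nat -> 'M[R]_n)
    (x y d : nat -> 'cV[R]_n) : Prop := Sgp {
  sgp_alpha_bounds : 0 < alpha_min <= alpha_max;
  sgp_mu : 1 <= mu;
  sgp_delta : 0 < delta < 1;
  sgp_beta : 0 < beta < 1;
  sgp_x0 : Omega (x 0%N);
  sgp_alpha : forall k, alpha_min <= alpha k <= alpha_max;
  sgp_muk : forall k, 1 <= muk k <= mu;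
  sgp_D : forall k, Mset (muk k) (D k);
  sgp_y : forall k,
    is_projection (invmx (D k)) Omega
      (x k - alpha k *: (D k *m g (x k))) (y k);
  sgp_d : forall k, d k = y k - x k;
  sgp_lam : forall k, armijo_linesearch f g delta beta (x k) (d k) (lam k);
  sgp_x : forall k, x k.+1 = x k + lam k *: d k }.

End Definitions.

(* Main.v *)
Require Import Defs.
From HB Require Import structures.
From mathcomp Require Import all_boot all_order all_algebra.
From mathcomp Require Import all_classical all_reals all_analysis.
From mathcomp Require Import ring lra.
Import Order.TTheory GRing.Theory Num.Theory.
Import numFieldNormedType.Exports.

Set Implicit Arguments.
Unset Strict Implicit.
Unset Printing Implicit Defensive.

Local Open Scope classical_set_scope.
Local Open Scope ring_scope.

(** The variational inequality of the projection, the bound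
    [mu_k^-1 |u|^2 <= u^T D_k^-1 u <= mu_k |u|^2] and convexity give, for
    every solution [w], the quasi-Fejer estimate
    [|x_(k+1) - w|^2 <= (1 + zeta_k) |x_k - w|^2 + C (f x_k - f x_(k+1))],
    whose error term telescopes. Hence [x] is bounded and has a cluster point
    [xbar], and once [xbar] is known to be a solution, the estimate for
    [w := xbar] forces convergence of the whole sequence. If [xbar] were not a
    solution, the slopes [- g(x_k)^T d_k] would stay away from [0] for [x_k]
    near [xbar]; by sufficient decrease [lam_k] would be small, so the Armijo
    test fails at [lam_k / delta], and convexity turns this failure into a
    lower bound on the variation of [g] near [xbar] that contradicts its
    continuity. *)

(** * Scalar products and quadratic forms *)

Lemma dotpE (R : realType) n (u v : 'cV[R]_n) :
  dotp u v = \sum_i u i 0 * v i 0.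
Proof. by rewrite /dotp mxE; apply: eq_bigr => i _; rewrite mxE. Qed.

Lemma dotpC (R : realType) n (u v : 'cV[R]_n) : dotp u v = dotp v u.
Proof. by rewrite !dotpE; apply: eq_bigr => i _; rewrite mulrC. Qed.

Lemma dotpDl (R : realType) n (u v w : 'cV[R]_n) :
  dotp (u + v) w = dotp u w + dotp v w.
Proof. by rewrite /dotp linearD mulmxDl mxE. Qed.

Lemma dotpZl (R : realType) n (a : R) (u v : 'cV[R]_n) :
  dotp (a *: u) v = a * dotp u v.
Proof. by rewrite /dotp linearZ -scalemxAl mxE. Qed.

Lemma dotpDr (R : realType) n (u v w : 'cV[R]_n) :
  dotp u (v + w) = dotp u v + dotp u w.
Proof. by rewrite dotpC dotpDl !(dotpC u). Qed.

Lemma dotpZr (R : realType) n (a : R) (u v : 'cV[R]_n) :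
  dotp u (a *: v) = a * dotp u v.
Proof. by rewrite dotpC dotpZl dotpC. Qed.

Lemma dotpNl (R : realType) n (u v : 'cV[R]_n) : dotp (- u) v = - dotp u v.
Proof. by rewrite -scaleN1r dotpZl mulN1r. Qed.

Lemma dotpNr (R : realType) n (u v : 'cV[R]_n) : dotp u (- v) = - dotp u v.
Proof. by rewrite dotpC dotpNl dotpC. Qed.

Lemma dotp0l (R : realType) n (u : 'cV[R]_n) : dotp 0 u = 0.
Proof. by rewrite -(scale0r u) dotpZl mul0r. Qed.

Lemma dotp_mxC (R : realType) n (A : 'M[R]_n) (u v : 'cV[R]_n) :
  A^T = A -> dotp u (A *m v) = dotp v (A *m u).
Proof.
move=> Asym; rewrite dotpC /dotp trmx_mul Asym.
by rewrite -mulmxA.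
Qed.

Lemma ler_entry_norm (R : realType) m n (A : 'M[R]_(m, n)) i j :
  `|A i j| <= `|A|.
Proof.
rewrite [leRHS]/Num.norm /= mx_normrE.
by apply: (le_bigmax _ (fun ij => `|A ij.1 ij.2|) (i, j)).
Qed.

Lemma normr_dotp_le (R : realType) n (u v : 'cV[R]_n) :
  `|dotp u v| <= n%:R * (`|u| * `|v|).
Proof.
rewrite dotpE (le_trans (ler_norm_sum _ _ _))//.
rewrite (le_trans (ler_sum _ (G := fun=> `|u| * `|v|) _))//.
  by move=> i _; rewrite normrM ler_pM// ler_entry_norm.
by rewrite sumr_const card_ord mulr_natl.
Qed.

Lemma dotpp_ge0 (R : realType) n (u : 'cV[R]_n) : 0 <= dotp u u.
Proof. by rewrite dotpE sumr_ge0// => i _; rewrite -expr2 sqr_ge0. Qed.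

Lemma dotpp_eq0 (R : realType) n (u : 'cV[R]_n) : dotp u u = 0 -> u = 0.
Proof.
rewrite dotpE => /psumr_eq0P u0.
apply/colP => i; rewrite mxE; apply/eqP.
by rewrite -sqrf_eq0 expr2 u0// => j _; rewrite -expr2 sqr_ge0.
Qed.

(** The sup norm is attained at some entry, whose square is one term of the sum. *)
Lemma sqr_norm_le_dotpp (R : realType) n (u : 'cV[R]_n) : `|u| ^+ 2 <= dotp u u.
Proof.
rewrite /Num.norm /=.
have [->|/mx_norm_neq0 [[i j] /= ->]] := eqVneq (mx_norm u) 0.
  by rewrite expr0n dotpp_ge0.
rewrite (ord1 j) real_normK ?num_real// dotpE (bigD1 i)//= -expr2 lerDl.
by rewrite sumr_ge0// => k _; rewrite -expr2 sqr_ge0.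
Qed.

Lemma norm_trmx (R : realType) m n (A : 'M[R]_(m, n)) : `|A^T| = `|A|.
Proof.
suff le_trmx m' n' (B : 'M[R]_(m', n')) : `|B^T| <= `|B|.
  by apply/le_anti; rewrite le_trmx -{1}(trmxK A) le_trmx.
rewrite [leLHS]/Num.norm /= mx_normrE; apply/bigmax_leP; split=> // ij _.
by rewrite mxE ler_entry_norm.
Qed.

Lemma trmx_is_continuous (R : realType) m n :
  continuous (fun A : 'M[R]_(m, n) => A^T).
Proof.
move=> A; apply/(@cvgrPdist_lt _ _ _ _ (nbhs_filter A)) => e e0.
apply/nbhs_ballP; exists e => //= B.
by rewrite -ball_normE /= -linearB norm_trmx.
Qed.

(** Transposition is a continuous isometry, so compactness is carried over from the bounded closed
    ball of row vectors. *)
Lemma compact_cV_ball (R : realType) n (M : R) :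
  compact [set v : 'cV[R]_n | `|v| <= M].
Proof.
have -> : [set v : 'cV[R]_n | `|v| <= M] =
    trmx @` [set v : 'rV[R]_n | `|v| <= M].
  apply/seteqP; split => [v vM|_ [v vM <-]] /=; last by rewrite norm_trmx.
  by exists v^T; rewrite ?trmxK//= norm_trmx.
apply: continuous_compact.
  exact/continuous_subspaceT/trmx_is_continuous.
apply: bounded_closed_compact.
  exists M; split => [|N MN v /= vM]; first exact: num_real.
  by rewrite (le_trans vM) ?ltW.
have /continuous_closedP := @norm_continuous R 'rV[R]_n.
by move=> /(_ [set x | x <= M]); apply.
Qed.

Lemma quadratic_form_continuous (R : realType) n (A : 'M[R]_n) :
  continuous (fun v : 'cV[R]_n => dotp v (A *m v)).
Proof.
have -> : (fun v : 'cV[R]_n => dotp v (A *m v)) =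
    (fun v => \sum_i v i 0 * \sum_j A i j * v j 0).
  by apply/funext => u; rewrite dotpE; apply: eq_bigr => i _; rewrite mxE.
apply: continuous_big => [|i _ v]; first exact: add_continuous.
apply: continuousM; first exact: coord_continuous.
apply: continuous_big => [|j _ w]; first exact: add_continuous.
by apply: continuousM; [exact: cst_continuous|exact: coord_continuous].
Qed.

(** The Rayleigh quotient attains its minimum [m] on the compact unit sphere, and first-order
    optimality makes the minimiser an eigenvector. Size [n.+1] keeps the sphere nonempty. *)
Lemma symmetric_min_eigenvector (R : realType) n (A : 'M[R]_n.+1) : A^T = A ->
  exists m (v : 'cV[R]_n.+1), [/\ v != 0, A *m v = m *: v &
    forall u : 'cV[R]_n.+1, m * dotp u u <= dotp u (A *m u)].
Proof.
move=> Asym.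
pose S := [set v : 'cV[R]_n.+1 | dotp v v = 1].
have S0 : S !=set0.
  exists (delta_mx 0 0); rewrite /S /= dotpE (bigD1 0)//= !mxE !eqxx mulr1.
  by rewrite big1 ?addr0// => i /negbTE i0; rewrite !mxE i0 mul0r.
have cptS : compact S.
  apply: subclosed_compact (@compact_cV_ball R n.+1 1) _.
    have /continuous_closedP := @quadratic_form_continuous R n.+1 1%:M.
    move=> /(_ [set x | x = 1] (closed_eq (y:=1))); congr closed.
    by apply/seteqP; split=> v /=; rewrite mul1mx.
  move=> v /= v1; rewrite -(@ler_pXn2r _ 2)// ?nnegrE// expr1n.
  by rewrite (le_trans (sqr_norm_le_dotpp v)) ?v1.
have [v vS vmin] : exists2 v : 'cV[R]_n.+1, dotp v v = 1 &
    forall u : 'cV[R]_n.+1, dotp u u = 1 -> dotp v (A *m v) <= dotp u (A *m u).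
  have qA := continuous_subspaceT (@quadratic_form_continuous R _ A).
  have [v /set_mem vS vmin] := compact_EVT_min S0 cptS (qA _).
  by exists v => // u uS; apply/vmin/mem_set.
pose m := dotp v (A *m v).
have mmin (u : 'cV[R]_n.+1) : m * dotp u u <= dotp u (A *m u).
  have [->|u0] := eqVneq u 0; first by rewrite !dotp0l mulr0.
  have uu0 : 0 < dotp u u.
    by rewrite lt_def dotpp_ge0 andbT; apply: contra_neq u0 => /dotpp_eq0.
  have := vmin ((Num.sqrt (dotp u u))^-1 *: u).
  rewrite -scalemxAr !dotpZl !dotpZr !mulrA -invfM -expr2.
  rewrite sqr_sqrtr ?dotpp_ge0// mulVf ?gt_eqF// => /(_ erefl).
  by rewrite -/m mulrC ler_pdivlMr.
exists m, v; split => //.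
  by apply/eqP => v0; move: vS => /eqP; rewrite v0 dotp0l eq_sym oner_eq0.
apply/subr0_eq.
(* The form [u |-> u^T A u - m u^T u] is nonnegative and vanishes at [v],
   so its derivative at [v] vanishes in the direction [w := A v - m v]. *)
move: {-1}(A *m v - m *: v) (erefl (A *m v - m *: v)) => w wdef.
have wE : dotp w w = dotp w (A *m v) - m * dotp w v.
  by rewrite -{2}wdef dotpDr dotpNr dotpZr.
apply: dotpp_eq0; apply/eqP; rewrite eq_le dotpp_ge0 andbT.
(* Minimality tested at [v - t *: w] and divided by [t]; letting [t] tend to 0 then gives
   [dotp w w <= 0]. *)
have ineq t : 0 < t -> 2 * dotp w w <= t * (dotp w (A *m w) - m * dotp w w).
  move=> t0; rewrite -subr_ge0 -(pmulr_rge0 _ t0).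
  have := mmin (v - t *: w); rewrite -subr_ge0.
  rewrite mulmxBr -scalemxAr !(dotpDl, dotpDr, dotpNl, dotpNr, dotpZl, dotpZr).
  rewrite (dotp_mxC v w Asym) (dotpC v w) -/m vS.
  by congr (0 <= _); rewrite wE; ring.
set q := dotp w (A *m w) - _ in ineq.
rewrite -(pmulr_rle0 _ (ltr0n R 2)); apply/ler_addgt0Pl => e e0; rewrite addr0.
have q1 : 0 < `|q| + 1 by rewrite ltr_wpDl.
apply: le_trans (ineq (e / (`|q| + 1)) _) _; first by rewrite divr_gt0.
rewrite mulrAC ler_pdivrMr// ler_pM2l//.
by rewrite (le_trans (ler_norm q))// lerDl.
Qed.

(** The best lower constant of the form is itself an eigenvalue, so [c] lies below it. Size 0 has no
    eigenvalue and is treated apart. *)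
Lemma eigenvalue_ge_quadratic_form (R : realType) n (A : 'M[R]_n) (c : R) :
  A^T = A -> (forall a, eigenvalue A a -> c <= a) ->
  forall u : 'cV[R]_n, c * dotp u u <= dotp u (A *m u).
Proof.
case: n A => [|n] A Asym cA u.
  by rewrite [u]flatmx0 mulmx0 !dotpE !big_ord0 mulr0.
have [m [v [v0 Av mA]]] := symmetric_min_eigenvector Asym.
apply: le_trans (mA u); rewrite ler_wpM2r ?dotpp_ge0// cA//.
apply/eigenvalueP; exists v^T; last by rewrite trmx_eq0.
by rewrite -{1}Asym -trmx_mul Av linearZ.
Qed.

Lemma eigenvalue_le_quadratic_form (R : realType) n (A : 'M[R]_n) (c : R) :
  A^T = A -> (forall a, eigenvalue A a -> a <= c) ->
  forall u : 'cV[R]_n, dotp u (A *m u) <= c * dotp u u.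
Proof.
move=> Asym Ac u.
have := @eigenvalue_ge_quadratic_form R n (- A) (- c).
rewrite linearN/= Asym => /(_ erefl) /(_ _ u); rewrite mulNmx dotpNr mulNr lerN2.
apply=> a /eigenvalueP[v vA v0]; rewrite lerNl Ac//.
by apply/eigenvalueP; exists v => //; rewrite -[A]opprK mulmxN vA scaleNr.
Qed.

Lemma posdefmx_unit (R : realType) n (A : 'M[R]_n) : posdefmx A -> A \in unitmx.
Proof.
case=> Asym Apos; rewrite -row_free_unit -kermx_eq0; apply/eqP/row_matrixP => i.
rewrite row0; apply/eqP; apply: contraT => ki0.
have := Apos (row i (kermx A))^T; rewrite trmx_eq0 => /(_ ki0).
by rewrite -{2}Asym -trmx_mul -row_mul mulmx_ker row0 trmx0 dotpC dotp0l ltxx.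
Qed.

(** Inverting a matrix inverts its eigenvalues, and the interval from [mu^-1] to [mu] is stable
    under inversion. *)
Lemma Mset_inv_bounds (R : realType) n (mu : R) (A : 'M[R]_n) :
  0 < mu -> Mset mu A ->
  [/\ A \in unitmx, (invmx A)^T = invmx A,
    (forall u : 'cV[R]_n, mu^-1 * dotp u u <= dotp u (invmx A *m u)) &
    (forall u : 'cV[R]_n, dotp u (invmx A *m u) <= mu * dotp u u)].
Proof.
move=> mu0 [Apd Aeig]; have Au := posdefmx_unit Apd.
have symV : (invmx A)^T = invmx A by rewrite trmx_inv Apd.1.
have eigV a : eigenvalue (invmx A) a -> mu^-1 <= a <= mu.
  move=> /eigenvalueP[v vA v0].
  have vE : v = a *: (v *m A) by rewrite scalemxAl -vA mulmxKV.
  have a0 : a != 0 by apply: contra_neq v0 => a0; rewrite vE a0 scale0r.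
  have /Aeig : eigenvalue A a^-1.
    by apply/eigenvalueP; exists v => //; rewrite {2}vE scalerA mulVf// scale1r.
  move=> /andP[lo hi].
  have ia0 : 0 < a^-1 by rewrite (lt_le_trans _ lo)// invr_gt0.
  have {}a0 : 0 < a by rewrite -invr_gt0.
  by rewrite lef_pV2 in lo => //; rewrite lo -[a]invrK lef_pV2 ?posrE// hi.
split => //.
  by apply: eigenvalue_ge_quadratic_form => // a /eigV /andP[].
by apply: eigenvalue_le_quadratic_form => // a /eigV /andP[].
Qed.

(** * Quasi-Fejer sequences and projections *)

(** A discrete Gronwall argument: the factors [1 + zeta k <= expR (zeta k)] multiply to the
    exponential of a partial sum, while the errors telescope to [C * (F N - F k)]. *)
Lemma quasi_fejer_bound (R : realType) (a F zeta : nat -> R) (C : R) :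
  0 <= C -> (forall k, 0 <= zeta k) -> cvgn (series zeta) ->
  (forall k, 0 <= a k) -> {homo F : i j / (i <= j)%N >-> j <= i} ->
  (forall k, a k.+1 <= (1 + zeta k) * a k + C * (F k - F k.+1)) ->
  forall N k, (N <= k)%N ->
    a k <= expR (limn (series zeta)) * (a N + C * (F N - F k)).
Proof.
move=> C0 zeta0 zetacvg a0 Fmono aS N k Nk.
have szeta_mono : {homo series zeta : i j / (i <= j)%N >-> i <= j}.
  by move=> i j ij; rewrite -subr_ge0 sub_series_geq// sumr_ge0.
have bound j : a (N + j)%N <= expR (series zeta (N + j)%N - series zeta N) *
    (a N + C * (F N - F (N + j)%N)).
  elim: j => [|j IH]; first by rewrite addn0 !subrr expR0 mulr0 addr0 mul1r.
  rewrite addnS (le_trans (aS _))//.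
  have -> : series zeta (N + j).+1 - series zeta N =
      zeta (N + j)%N + (series zeta (N + j)%N - series zeta N).
    by rewrite seriesSr addrAC addrC.
  set s := series zeta (N + j)%N - _ in IH *.
  have s0 : 0 <= s by rewrite subr_ge0 szeta_mono// leq_addr.
  have -> : a N + C * (F N - F (N + j).+1) =
      a N + C * (F N - F (N + j)%N) + C * (F (N + j)%N - F (N + j).+1) by ring.
  have CF i l : (i <= l)%N -> 0 <= C * (F i - F l).
    by move=> il; rewrite mulr_ge0// subr_ge0 Fmono.
  rewrite [leRHS]mulrDr lerD//.
    rewrite expRD -mulrA ler_pM ?addr_ge0// ?expR_ge1Dx//.
  rewrite -[leLHS]mul1r ler_wpM2r// ?CF//.
  by rewrite (le_trans _ (expR_ge1Dx _))// lerDl addr_ge0.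
(* The sum of [zeta] from [N] to [k] is at most the whole sum, since all terms are nonnegative. *)
have := bound (k - N)%N; rewrite subnKC// => /le_trans; apply.
rewrite ler_wpM2r//.
  by rewrite addr_ge0// mulr_ge0// subr_ge0 Fmono.
rewrite ler_expR lerBlDr (le_trans (nondecreasing_cvgn_le szeta_mono zetacvg k))//.
by rewrite lerDl (le_trans _ (szeta_mono 0%N N _))// seriesEnat /= big_geq.
Qed.

Lemma convex_set_segment (R : realType) n (Omega : set 'cV[R]_n) (u v : 'cV[R]_n)
    (t : R) : convex_set Omega -> Omega u -> Omega v -> 0 <= t <= 1 ->
  Omega (u + t *: (v - u)).
Proof.
move=> Oconv Ou Ov /andP[t0 t1].
have := Oconv v u (Itv01 t0 t1) (mem_set Ov) (mem_set Ou).
move=> /set_mem; congr Omega.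
rewrite /conv /= /unstable.onem scalerBl scale1r scalerBr.
by rewrite addrC -addrA (addrC (- _)).
Qed.

Lemma quadratic_formDZ (R : realType) n (A : 'M[R]_n) (u v : 'cV[R]_n) (t : R) :
  A^T = A -> dotp (v + t *: u) (A *m (v + t *: u)) =
  dotp v (A *m v) + 2 * t * dotp (A *m v) u + t ^+ 2 * dotp u (A *m u).
Proof.
move=> Asym; rewrite mulmxDr -scalemxAr !(dotpDl, dotpDr, dotpZl, dotpZr).
by rewrite (dotp_mxC v u Asym) (dotpC u (A *m v)); ring.
Qed.

(** Compare [y] with the points [y + t *: (w - y)] of the segment to [w], divide by [t] and let [t]
    tend to 0. *)
Lemma projection_variational (R : realType) n (A : 'M[R]_n)
    (Omega : set 'cV[R]_n) (z y w : 'cV[R]_n) :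
  A^T = A -> (forall u : 'cV[R]_n, 0 <= dotp u (A *m u)) ->
  convex_set Omega -> is_projection A Omega z y -> Omega w ->
  0 <= dotp (A *m (y - z)) (w - y).
Proof.
move=> Asym A0 Oconv [Oy ymin] Ow.
set u := w - y; set v := y - z.
have ineq t : 0 < t -> t <= 1 -> 0 <= t * dotp u (A *m u) + 2 * dotp (A *m v) u.
  move=> t0 t1; rewrite -(pmulr_rge0 _ t0).
  have t01 : 0 <= t <= 1 by rewrite ltW.
  have := ymin _ (convex_set_segment Oconv Oy Ow t01).
  rewrite ler_sqrt ?A0// -/u addrAC -/v -subr_ge0.
  rewrite quadratic_formDZ//.
  by congr (0 <= _); ring.
rewrite -(pmulr_rge0 _ (ltr0n R 2)); apply/ler_addgt0Pl => e e0.
set q := dotp u (A *m u) in ineq.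
have q1 : 0 < q + 1 by rewrite ltr_wpDl// A0.
(* The bound 1 keeps the comparison point in [Omega]; the other bound makes [t * q <= e]. *)
have t0 : 0 < Num.min 1 (e / (q + 1)) by rewrite lt_min ltr01 divr_gt0.
have := ineq _ t0; rewrite ge_min lexx => /(_ erefl) /le_trans; apply.
rewrite lerD2r (@le_trans _ _ (e / (q + 1) * q))//.
  by rewrite ler_wpM2r ?A0// ge_min lexx orbT.
by rewrite mulrAC ler_pdivrMr// ler_pM2l// lerDl.
Qed.

(** The metric [invmx A] cancels the scaling [A] of the gradient step, so only [alpha *: c]
    remains. *)
Lemma scaled_projection_variational (R : realType) n (A : 'M[R]_n)
    (Omega : set 'cV[R]_n) (alpha : R) (x y c w : 'cV[R]_n) :
  A \in unitmx -> (invmx A)^T = invmx A ->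
  (forall u : 'cV[R]_n, 0 <= dotp u (invmx A *m u)) -> convex_set Omega ->
  is_projection (invmx A) Omega (x - alpha *: (A *m c)) y -> Omega w ->
  dotp (invmx A *m (y - x)) (y - w) <= alpha * dotp c (w - y).
Proof.
move=> Au symV V0 Oconv yproj Ow.
have := projection_variational symV V0 Oconv yproj Ow.
rewrite opprB addrCA -opprB mulmxBr -scalemxAr mulKmx//.
rewrite dotpDl dotpZl dotpNl -(opprB y w) !dotpNr -(opprB w y).
rewrite !mulmxN !dotpNl !dotpNr !opprK; lra.
Qed.

(** * One step of the method *)

Section ScaledGradientProjection.

Variables (R : realType) (n : nat).
Variables (Omega : set 'cV[R]_n) (f : 'cV[R]_n -> R) (g : 'cV[R]_n -> 'cV[R]_n).
Variables (alpha_min alpha_max mu delta beta : R) (alpha muk lam : nat -> R).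
Variables (D : nat -> 'M[R]_n) (x y d : nat -> 'cV[R]_n).
Hypothesis Omega_convex : convex_set Omega.
Hypothesis f_convex : convex_on Omega f g.
Hypothesis sgpx :
  sgp Omega f g alpha_min alpha_max mu delta beta alpha muk lam D x y d.

Let slope k : R := - dotp (g (x k)) (d k).

Lemma sgp_parameters_gt0 : [/\ 0 < alpha_min, 0 < alpha_max, 0 < mu,
  0 < delta < 1 & 0 < beta < 1].
Proof.
have /andP[a0 a1] := sgp_alpha_bounds sgpx; split=> //.
- exact: lt_le_trans a1.
- exact: lt_le_trans (sgp_mu sgpx).
- exact: sgp_delta sgpx.
- exact: sgp_beta sgpx.
Qed.

Lemma sgp_lam_itv k : 0 < lam k <= 1.
Proof.
have /andP[d0 d1] := sgp_delta sgpx.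
have [m [-> _ _]] := sgp_lam sgpx k.
by rewrite exprn_gt0//= exprn_ile1 ?ltW.
Qed.

Lemma sgp_segment k (t : R) : Omega (x k) -> 0 <= t <= 1 ->
  Omega (x k + t *: d k).
Proof.
move=> Ox t01; rewrite (sgp_d sgpx k).
by apply: convex_set_segment => //; have [] := sgp_y sgpx k.
Qed.

Lemma sgp_mem k : Omega (x k).
Proof.
elim: k => [|k IH]; first exact: sgp_x0 sgpx.
rewrite (sgp_x sgpx k); apply: sgp_segment => //.
by have /andP[/ltW-> ->] := sgp_lam_itv k.
Qed.

Lemma sgp_metric k : [/\ D k \in unitmx, (invmx (D k))^T = invmx (D k),
  (forall u : 'cV[R]_n, (muk k)^-1 * dotp u u <= dotp u (invmx (D k) *m u)) &
  (forall u : 'cV[R]_n, dotp u (invmx (D k) *m u) <= muk k * dotp u u)].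
Proof.
have /andP[m1 _] := sgp_muk sgpx k.
by apply: Mset_inv_bounds (sgp_D sgpx k); rewrite (lt_le_trans _ m1).
Qed.

Lemma sgp_metric_ge0 k (u : 'cV[R]_n) : 0 <= dotp u (invmx (D k) *m u).
Proof.
have [_ _ lo _] := sgp_metric k; apply: le_trans (lo u).
have /andP[m1 _] := sgp_muk sgpx k.
by rewrite mulr_ge0 ?dotpp_ge0// invr_ge0 (le_trans _ m1).
Qed.

(** Common source of the estimates below: [w := x k] bounds the slope from below, and a general [w]
    serves the quasi-Fejer and gap estimates. *)
Lemma sgp_variational k w : Omega w ->
  dotp (invmx (D k) *m d k) (x k - w) <=
  alpha k * (dotp (g (x k)) (w - x k) + slope k) -
  dotp (d k) (invmx (D k) *m d k).
Proof.
move=> Ow; have [Du symV _ _] := sgp_metric k.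
have := scaled_projection_variational Du symV (sgp_metric_ge0 k) Omega_convex
  (sgp_y sgpx k) Ow.
rewrite -(sgp_d sgpx k).
have -> : y k = x k + d k by rewrite (sgp_d sgpx k) addrC subrK.
rewrite -addrA (addrC (d k)) addrA opprD addrA !dotpDr dotpNr.
by rewrite (dotpC (d k)) !dotpNr /slope; lra.
Qed.

Lemma sgp_slope_lower_bound k :
  dotp (d k) (invmx (D k) *m d k) <= alpha k * slope k.
Proof.
have := sgp_variational k (sgp_mem k).
by rewrite subrr !(dotpC _ 0) !dotp0l add0r subr_ge0.
Qed.

Lemma sgp_slope_ge0 k : 0 <= slope k.
Proof.
have := le_trans (sgp_metric_ge0 k (d k)) (sgp_slope_lower_bound k).
have /andP[a1 _] := sgp_alpha sgpx k; have [a0 _ _ _ _] := sgp_parameters_gt0.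
by rewrite pmulr_rge0// (lt_le_trans a0).
Qed.

Lemma sgp_sufficient_decrease k :
  beta * (lam k * slope k) <= f (x k) - f (x k.+1).
Proof.
have [m [_ + _]] := sgp_lam sgpx k.
by rewrite /armijo -(sgp_x sgpx k) /slope; lra.
Qed.

Lemma sgp_value_nonincreasing :
  {homo (fun k => f (x k)) : i j / (i <= j)%N >-> j <= i}.
Proof.
apply/nonincreasing_seqP => k; rewrite -subr_ge0.
apply: le_trans (sgp_sufficient_decrease k).
have [_ _ _ _ /andP[b0 _]] := sgp_parameters_gt0.
have /andP[l0 _] := sgp_lam_itv k.
by rewrite !mulr_ge0 ?sgp_slope_ge0// ltW.
Qed.

(** Expand the square of [x k - w + lam k *: d k] in the metric of [invmx (D k)]. Passing to this
    metric and back costs [muk k] each time, whence [muk k ^+ 2]. *)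
Lemma sgp_quasi_fejer k w : Omega w -> f w <= f (x k) ->
  dotp (x k.+1 - w) (x k.+1 - w) <= muk k ^+ 2 * dotp (x k - w) (x k - w) +
    2 * alpha_max * mu / beta * (f (x k) - f (x k.+1)).
Proof.
move=> Ow fw.
have [_ symV lo hi] := sgp_metric k.
have [_ am0 mu0 _ /andP[b0 _]] := sgp_parameters_gt0.
have /andP[a0 a1] : 0 < alpha k <= alpha_max.
  have /andP[a0 ->] := sgp_alpha sgpx k.
  by rewrite (lt_le_trans _ a0)//; have [] := sgp_parameters_gt0.
have /andP[m1 m2] := sgp_muk sgpx k; have m0 : 0 < muk k by exact: lt_le_trans m1.
have /andP[l0 l1] := sgp_lam_itv k.
have s0 := sgp_slope_ge0 k; have q0 := sgp_metric_ge0 k (d k).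
have decr := sgp_sufficient_decrease k.
have fcvx := f_convex (sgp_mem k) Ow.
have var := sgp_variational k Ow.
have expand := quadratic_formDZ (d k) (x k - w) (lam k) symV.
have xE : x k - w + lam k *: d k = x k.+1 - w by rewrite (sgp_x sgpx) addrAC.
have pC : dotp (invmx (D k) *m (x k - w)) (d k) =
    dotp (invmx (D k) *m d k) (x k - w).
  by rewrite dotpC (dotp_mxC _ _ symV) dotpC.
rewrite xE pC in expand.
have {lo} := lo (x k.+1 - w); have {hi} := hi (x k - w).
move: expand var q0 fcvx decr s0.
set q := dotp (d k) (invmx _ *m d k); set p := dotp (invmx _ *m d k) _.
set Q := dotp (x k - w) (invmx _ *m _); set Q' := dotp (x k.+1 - w) (invmx _ *m _).
set A := dotp (x k - w) _; set A' := dotp (x k.+1 - w) _.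
set s := slope k; set a := alpha k in a0 a1 *; set m := muk k in m0 m1 m2 *.
set l := lam k in l0 l1 *; set G := dotp _ _; set df := f (x k) - f (x k.+1).
move=> expand var q0 fcvx decr s0 hi lo.
(* By convexity and [f w <= f (x k)], the term [G] is at most 0. *)
have p1 : p <= a * s - q.
  by apply: (le_trans var); rewrite lerB// ler_pM2l// gerDr; lra.
(* The terms in [q] add up to at most [(l ^+ 2 - 2 * l) * q], which is nonpositive because
   [l <= 1]. *)
have Q1 : Q' <= Q + 2 * a * (l * s).
  have lp : l * p <= l * (a * s - q) by rewrite ler_pM2l.
  have lq : l * (l * q) <= l * q by rewrite ler_pM2l// -[leRHS]mul1r ler_wpM2r.
  have lq0 : 0 <= l * q by rewrite mulr_ge0// ltW.
  by rewrite expand; nra.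
have ls : l * s <= df / beta by rewrite ler_pdivlMr// mulrC.
have ls0 : 0 <= l * s by rewrite mulr_ge0// ltW.
have -> : 2 * alpha_max * mu / beta * df = mu * (2 * alpha_max * (df / beta)).
  by field; rewrite gt_eqF.
have A1 : A' <= m * Q' by rewrite mulrC -ler_pdivrMr// mulrC.
apply: (le_trans A1); apply: (@le_trans _ _ (m * (Q + 2 * a * (l * s)))).
  by rewrite ler_pM2l.
rewrite mulrDr lerD//; first by rewrite expr2 -mulrA ler_pM2l.
apply: ler_pM => //; first exact: ltW.
  by rewrite !mulr_ge0// ltW.
by apply: ler_pM => //; [rewrite mulr_ge0// ltW|rewrite ler_pM2l].
Qed.

(* Young's inequality in the metric of [D_k^-1] with weight [s]. *)
Lemma sgp_gap_le k w (s : R) : Omega w -> 0 < s ->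
  2 * alpha k * (f (x k) - f w) <=
  s * mu * dotp (x k - w) (x k - w) + alpha k * slope k * (s^-1 + 2).
Proof.
move=> Ow s0.
have [_ symV _ hi] := sgp_metric k.
have /andP[a0 _] : 0 < alpha k <= alpha_max.
  have /andP[a0 ->] := sgp_alpha sgpx k.
  by rewrite (lt_le_trans _ a0)//; have [] := sgp_parameters_gt0.
have /andP[_ m2] := sgp_muk sgpx k.
have q0 := sgp_metric_ge0 k (d k).
have fcvx := f_convex (sgp_mem k) Ow.
have var := sgp_variational k Ow.
have slb := sgp_slope_lower_bound k.
have young := sgp_metric_ge0 k (d k + s *: (x k - w)).
rewrite quadratic_formDZ// in young.
have {hi} hi : dotp (x k - w) (invmx (D k) *m (x k - w)) <=
    mu * dotp (x k - w) (x k - w).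
  by apply: (le_trans (hi _)); rewrite ler_wpM2r ?dotpp_ge0.
move: young hi var q0 fcvx slb.
set q := dotp (d k) (invmx _ *m d k); set p := dotp (invmx _ *m d k) _.
set Q := dotp (x k - w) (invmx _ *m _).
set A := dotp (x k - w) _; set S := slope k; set a := alpha k in a0 *.
set G := dotp _ _; set df := f (x k) - f w.
move=> young hi var q0 fcvx slb.
have aG : a * G <= - (a * df) by rewrite -mulrN ler_pM2l// /df; lra.
have yg : - (2 * p) <= s^-1 * q + s * Q.
  have : 0 <= s^-1 * (q + 2 * s * p + s ^+ 2 * Q).
    by rewrite mulr_ge0// invr_ge0 ltW.
  have -> : s^-1 * (q + 2 * s * p + s ^+ 2 * Q) = s^-1 * q + 2 * p + s * Q.
    by field; rewrite gt_eqF.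
  lra.
have sq : s^-1 * q <= s^-1 * (a * S) by rewrite ler_pM2l// invr_gt0.
have sQ : s * Q <= s * (mu * A) by rewrite ler_pM2l.
rewrite mulrDr in var; nra.
Qed.

(** Up to constants, [|d k|^2] is at most the slope, which is at most [|g (x k)| |d k|]; one factor
    [|d k|] cancels. The factor [n] comes from the sup norm. *)
Lemma sgp_direction_bound k : `|d k| <= mu * alpha_max * n%:R * `|g (x k)|.
Proof.
have [_ _ lo _] := sgp_metric k; have {lo} lo := lo (d k).
have [a0 am0 mu0 _ _] := sgp_parameters_gt0.
have /andP[a1 a2] := sgp_alpha sgpx k.
have /andP[m1 m2] := sgp_muk sgpx k; have m0 : 0 < muk k by exact: lt_le_trans m1.
have slb := sgp_slope_lower_bound k; have s0 := sgp_slope_ge0 k.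
have [->|d0] := eqVneq (d k) 0.
  by rewrite normr0 !mulr_ge0// ltW.
rewrite -normr_gt0 in d0; rewrite -(ler_pM2r d0) -expr2.
apply: (le_trans (sqr_norm_le_dotpp _)).
have dd : dotp (d k) (d k) <= mu * (alpha_max * slope k).
  apply: (@le_trans _ _ (muk k * (alpha k * slope k))).
    by rewrite mulrC -ler_pdivrMr// mulrC (le_trans lo).
  apply: ler_pM => //; [exact: ltW|by rewrite mulr_ge0// (le_trans (ltW a0))|].
  exact: ler_wpM2r.
apply: (le_trans dd); rewrite -!mulrA ler_pM2l// ler_pM2l//.
apply: le_trans (normr_dotp_le _ _).
by rewrite /slope (le_trans (ler_norm _))// normrN.
Qed.

(** Here [t] is the last rejected trial step. Its failure bounds the increment of [f] from below,
    and the gradient inequality at the trial point bounds it from above by [t] times the directional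
    derivative there. *)
Lemma sgp_backtracked k : lam k < 1 -> exists t : R,
  [/\ 0 < t, t <= 1, delta * t = lam k &
      (1 - beta) * slope k <= dotp (g (x k + t *: d k) - g (x k)) (d k)].
Proof.
move=> lam1; have [_ _ _ /andP[d0 d1] _] := sgp_parameters_gt0.
have [[|m] [lamE _ nA]] := sgp_lam sgpx k; first by rewrite lamE expr0 ltxx in lam1.
exists (delta ^+ m); set t := delta ^+ m.
have t0 : 0 < t by rewrite exprn_gt0.
have t1 : t <= 1 by rewrite exprn_ile1// ltW.
split=> //; first by rewrite lamE exprS.
have /negP := nA m (ltnSn m); rewrite /armijo -/t -ltNge => nArm.
have Oz : Omega (x k + t *: d k).
  by apply: sgp_segment; [exact: sgp_mem|rewrite (ltW t0)].
have := f_convex Oz (sgp_mem k).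
rewrite opprD addNKr dotpNr dotpZr dotpDl dotpNl -/(slope k) => cvx.
rewrite -(ler_pM2l t0); move: nArm cvx; rewrite -[dotp (g (x k)) _]opprK -/(slope k).
nra.
Qed.

End ScaledGradientProjection.

(** * Convergence *)

(** Once [u N] is within [e] of the limit, later terms stay between the limit and [u N]. *)
Lemma nonincreasing_tail (R : realType) (u : nat -> R) (m e : R) :
  {homo u : i j / (i <= j)%N >-> j <= i} -> (forall k, m <= u k) -> 0 < e ->
  exists N, forall k, (N <= k)%N -> u N - u k < e.
Proof.
move=> umono um e0.
have ucvg : cvgn u.
  by apply: nonincreasing_is_cvgn => //; exists m => _ [k _ <-].
have /cvgrPdist_lt /(_ _ e0) [N _ uN] := ucvg.
exists N => k Nk; have := uN N (leqnn N); rewrite distrC.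
move=> /(le_lt_trans (ler_norm _)); apply: le_lt_trans.
by rewrite lerB// nonincreasing_cvgn_ge.
Qed.

Lemma bounded_cV_cluster (R : realType) n (u : nat -> 'cV[R]_n) (M : R) :
  (forall k, `|u k| <= M) ->
  exists a, forall e N, 0 < e -> exists2 k, (N <= k)%N & `|a - u k| < e.
Proof.
move=> uM; have [] := @compact_cV_ball R n M (u @ \oo) _.
  by exists 0%N => // k _ /=.
move=> a [_ ua]; exists a => e N e0.
have [||_ [[k Nk <-]]] := ua [set u k | k in [set k | (N <= k)%N]] (ball a e).
- by exists N => // k /= Nk; exists k.
- exact: nbhsx_ballx.
by rewrite -ball_normE; exists k.
Qed.

Lemma within_continuous_ball (R : realType) m n (Omega : set 'cV[R]_m)
    (g : 'cV[R]_m -> 'cV[R]_n) (a : 'cV[R]_m) (e : R) :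
  {within Omega, continuous g} -> Omega a -> 0 < e ->
  exists2 r : R, 0 < r &
    forall z, Omega z -> `|a - z| < r -> `|g a - g z| < e.
Proof.
move=> /subspace_continuousP gc Oa e0.
have /cvgrPdist_lt /(_ _ e0) := gc a Oa.
rewrite /within /= => /nbhs_ballP[r r0 rg]; exists r => // z Oz az.
by apply: rg => //; rewrite -ball_normE.
Qed.

Lemma sgp_cluster_value (R : realType) (n : nat)
    (Omega : set 'cV[R]_n) (f : 'cV[R]_n -> R) (g : 'cV[R]_n -> 'cV[R]_n)
    (alpha_min alpha_max mu delta beta : R) (alpha muk lam : nat -> R)
    (D : nat -> 'M[R]_n) (x y d : nat -> 'cV[R]_n) (xbar w : 'cV[R]_n) (B : R) :
  convex_set Omega -> {within Omega, continuous g} -> convex_on Omega f g ->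
  sgp Omega f g alpha_min alpha_max mu delta beta alpha muk lam D x y d ->
  solutions Omega f w -> (forall k, dotp (x k - w) (x k - w) <= B) ->
  Omega xbar ->
  (forall e N, 0 < e -> exists2 k, (N <= k)%N & `|xbar - x k| < e) ->
  f xbar <= f w.
Proof.
move=> Oconv gcont fconv sgpx [Ow wmin] xB Oxbar xcluster.
have [a0 am0 mu0 /andP[de0 de1] /andP[b0 b1]] := sgp_parameters_gt0 sgpx.
rewrite leNgt; apply/negP => fgap.
(* Half of the gap at [xbar] survives at nearby iterates, by the gradient inequality at [xbar]. *)
set c := (f xbar - f w) / 2; have c0 : 0 < c by rewrite divr_gt0// subr_gt0.
have B0 : 0 <= B by exact: le_trans (dotpp_ge0 _) (xB 0%N).
(* With this weight the distance term of [sgp_gap_le] is at most [alpha k * c], half of the left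
   side; the other half forces the slope to be at least [sig]. *)
set s := alpha_min * c / (mu * (B + 1)).
have B1 : 0 < B + 1 by rewrite ltr_wpDl.
have s0 : 0 < s by rewrite divr_gt0// mulr_gt0.
set sig := c / (s^-1 + 2).
have sig0 : 0 < sig by rewrite divr_gt0// addr_gt0// invr_gt0.
(* Bounds [|d k|] as soon as [g (x k)] is within 1 of [g xbar]. *)
set K := mu * alpha_max * n%:R * (`|g xbar| + 1).
have K0 : 0 <= K by rewrite !mulr_ge0 ?addr_ge0 ?(ltW mu0) ?(ltW am0).
(* Chosen so that a variation of [g] by [2 * e] along a direction of norm at most [K] stays below
   [(1 - beta) * sig]. *)
set e := (1 - beta) * sig / (2 * (n%:R * K + 1)).
have nK0 : 0 <= n%:R * K by rewrite mulr_ge0.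
have nK1 : 0 < n%:R * K + 1 by rewrite ltr_wpDl.
have bs0 : 0 < (1 - beta) * sig by rewrite mulr_gt0// subr_gt0.
have e0 : 0 < e by rewrite divr_gt0// mulr_gt0.
have [r r0 gr] : exists2 r : R, 0 < r & forall z, Omega z -> `|xbar - z| < r ->
    `|g xbar - g z| < Num.min e 1.
  by apply: within_continuous_ball; rewrite // lt_min e0 ltr01.
(* A trial step below [tau] moves the point by at most [r / 2]. *)
set tau := r / (2 * (K + 1)).
have K1 : 0 < K + 1 by rewrite ltr_wpDl.
have tau0 : 0 < tau by rewrite divr_gt0// mulr_gt0.
(* A decrease of [f] below [eta] with slope at least [sig] forces backtracking, and a last rejected
   step below [tau]. *)
set eta := beta * (Num.min 1 (delta * tau) * sig).
have eta0 : 0 < eta by rewrite mulr_gt0// mulr_gt0// lt_min ltr01 mulr_gt0.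
have fmono := sgp_value_nonincreasing Oconv sgpx.
have [N Ntail] : exists N, forall k, (N <= k)%N -> f (x N) - f (x k) < eta.
  apply: (nonincreasing_tail (m := f w) fmono) => // k.
  exact/wmin/(sgp_mem Oconv sgpx).
have q0 : 0 < n%:R * `|g xbar| + 1 by rewrite ltr_wpDl// mulr_ge0.
(* The first bound leaves room [r / 2] for the trial step; the second keeps the linear term at
   [xbar] below [c]. *)
have rho0 : 0 < Num.min (r / 2) (c / (n%:R * `|g xbar| + 1)).
  by rewrite lt_min divr_gt0//= divr_gt0.
have [k Nk] := xcluster _ N rho0.
rewrite lt_min => /andP[xr xc].
have Ox := sgp_mem Oconv sgpx k.
have gap : c <= f (x k) - f w.
  have := fconv _ _ Oxbar Ox.
  have := normr_dotp_le (g xbar) (x k - xbar).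
  rewrite distrC ler_norml => /andP[+ _].
  have : n%:R * (`|g xbar| * `|xbar - x k|) <= c.
    rewrite mulrA.
    apply: (@le_trans _ _ ((n%:R * `|g xbar| + 1) * `|xbar - x k|)).
      by rewrite ler_wpM2r// lerDl.
    by rewrite -ler_pdivlMl// mulrC ltW.
  by rewrite /c; lra.
have slope_lb : sig <= - dotp (g (x k)) (d k).
  have := sgp_gap_le Oconv fconv sgpx k Ow s0.
  have /andP[al0 _] := sgp_alpha sgpx k.
  have {}al0 := lt_le_trans a0 al0; have al1 := sgp_alpha sgpx k.
  have sB : s * mu * dotp (x k - w) (x k - w) <= alpha k * c.
    apply: (@le_trans _ _ (s * mu * (B + 1))).
      by rewrite ler_wpM2l ?(ltW (mulr_gt0 s0 mu0))// (le_trans (xB k))// lerDl.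
    have -> : s * mu * (B + 1) = alpha_min * c.
      by rewrite /s; field; rewrite !gt_eqF.
    by rewrite ler_pM2r//; case/andP: al1.
  move=> gapk; rewrite /sig ler_pdivrMr ?addr_gt0 ?invr_gt0//.
  rewrite -(ler_pM2l al0).
  have : alpha k * c <= alpha k * (f (x k) - f w) by rewrite ler_pM2l.
  by move: gapk sB; rewrite !mulrA; lra.
have lam_small : lam k < Num.min 1 (delta * tau).
  have decr := sgp_sufficient_decrease sgpx k.
  have fdiff : f (x k) - f (x k.+1) < eta.
    by apply: le_lt_trans (Ntail k.+1 (leqW Nk)); rewrite lerB// fmono.
  have /andP[l0 _] := sgp_lam_itv sgpx k.
  have := le_lt_trans decr fdiff; rewrite /eta ltr_pM2l//.
  move=> /(le_lt_trans (ler_wpM2l (ltW l0) slope_lb)).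
  by rewrite ltr_pM2r.
move: lam_small; rewrite lt_min => /andP[lam1 lamtau].
have [t [t0 t1 tE back]] := sgp_backtracked Oconv fconv sgpx lam1.
have ttau : t < tau by rewrite -(ltr_pM2l de0) tE.
have xkr : `|xbar - x k| < r.
  by rewrite (lt_trans xr)// ltr_pdivrMr// ltr_pMr// ltr1n.
have gk := gr _ Ox xkr.
have dK : `|d k| <= K.
  apply: (le_trans (sgp_direction_bound Oconv sgpx k)).
  rewrite ler_wpM2l ?mulr_ge0 ?(ltW mu0) ?(ltW am0)// ltW//.
  rewrite -[g (x k)](subrK (g xbar)) (le_lt_trans (ler_normD _ _))//.
  rewrite addrC ltrD2l distrC; move: gk; rewrite lt_min => /andP[_]; exact.
have Oz : Omega (x k + t *: d k) by apply: (sgp_segment Oconv sgpx) => //; rewrite (ltW t0).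
have gz : `|g xbar - g (x k + t *: d k)| < Num.min e 1.
  apply: gr => //; rewrite opprD addrA (le_lt_trans (ler_normB _ _))//.
  rewrite [ltRHS]splitr ltr_leD// normrZ gtr0_norm//.
  apply: (@le_trans _ _ (tau * (K + 1))).
    by apply: ler_pM => //; [exact: ltW|exact: ltW|rewrite (le_trans dK)// lerDl].
  have -> // : tau * (K + 1) = r / 2.
  by rewrite /tau; field; rewrite gt_eqF.
(* Both [x k] and the rejected point lie within [r] of [xbar], so [g] varies by at most [2 * e]
   between them, against the choice of [e]. *)
have : (1 - beta) * sig <= n%:R * (2 * e * K).
  apply: (@le_trans _ _ ((1 - beta) * - dotp (g (x k)) (d k))).
    by rewrite ler_pM2l// subr_gt0.
  apply: (le_trans back); apply: (le_trans (ler_norm _)).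
  apply: (le_trans (normr_dotp_le _ _)); rewrite ler_wpM2l//.
  apply: ler_pM => //.
  rewrite -(subrK (g xbar) (g (x k + _))) -addrA (le_trans (ler_normD _ _))//.
  rewrite mulr_natl mulr2n distrC; apply: lerD; apply: ltW.
    by move: gz; rewrite lt_min => /andP[].
  by move: gk; rewrite lt_min => /andP[].
have -> : n%:R * (2 * e * K) = (1 - beta) * sig * ((n%:R * K) / (n%:R * K + 1)).
  by rewrite /e; field; rewrite gt_eqF.
by apply/negP; rewrite -ltNge gtr_pMr// ltr_pdivrMr// mul1r ltrDl.
Qed.

Theorem theorem3p1 (R : realType) (n : nat)
    (Omega : set 'cV[R]_n) (f : 'cV[R]_n -> R) (g : 'cV[R]_n -> 'cV[R]_n)
    (alpha_min alpha_max mu delta beta : R)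
    (alpha muk lam zeta : nat -> R) (D : nat -> 'M[R]_n)
    (x y d : nat -> 'cV[R]_n) :
  closed Omega ->
  convex_set Omega ->
  continuously_differentiable_on Omega f g ->
  convex_on Omega f g ->
  solutions Omega f !=set0 ->
  sgp Omega f g alpha_min alpha_max mu delta beta alpha muk lam D x y d ->
  (forall k, muk k ^+ 2 = 1 + zeta k) ->
  (forall k, 0 <= zeta k) ->
  cvgn (series zeta) ->
  exists2 xstar : 'cV[R]_n, solutions Omega f xstar & x @ \oo --> xstar.
Proof.
move=> Oclosed Oconv [_ gcont] fconv [w wsol] sgpx mukE zeta0 zetacvg.
have Ox := sgp_mem Oconv sgpx.
have fmono := sgp_value_nonincreasing Oconv sgpx.
have [_ am0 mu0 _ /andP[b0 _]] := sgp_parameters_gt0 sgpx.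
set C := 2 * alpha_max * mu / beta.
have C0 : 0 <= C by rewrite divr_ge0 ?mulr_ge0// ltW.
set P := expR (limn (series zeta)); have P0 : 0 < P by exact: expR_gt0.
(* The starting index [N] stays free: 0 gives boundedness, and an index with [x N] near [xbar] gives
   convergence. *)
have fejer v : solutions Omega f v -> forall N k, (N <= k)%N ->
    dotp (x k - v) (x k - v) <=
    P * (dotp (x N - v) (x N - v) + C * (f (x N) - f (x k))).
  move=> [Ov vmin] N k Nk.
  apply: (quasi_fejer_bound (a := fun k => dotp (x k - v) (x k - v))
    (F := fun k => f (x k))) => // [j|j]; first exact: dotpp_ge0.
  by rewrite -mukE; apply: (sgp_quasi_fejer Oconv fconv sgpx) => //; exact/vmin.
set B := P * (dotp (x 0%N - w) (x 0%N - w) + C * (f (x 0%N) - f w)).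
have xB k : dotp (x k - w) (x k - w) <= B.
  apply: (le_trans (fejer w wsol 0%N k (leq0n k))).
  rewrite ler_pM2l// lerD2l ler_wpM2l// lerB//.
  by have [_] := wsol; apply.
have B0 : 0 <= B by exact: le_trans (dotpp_ge0 _) (xB 0%N).
have [xbar xcluster] : exists a, forall e N, 0 < e ->
    exists2 k, (N <= k)%N & `|a - x k| < e.
  apply: (@bounded_cV_cluster _ _ _ (Num.sqrt B + `|w|)) => k.
  rewrite -[x k](subrK w) (le_trans (ler_normD _ _))// lerD2r.
  rewrite -(@ler_pXn2r _ 2)// ?nnegrE ?sqrtr_ge0// sqr_sqrtr//.
  exact: le_trans (sqr_norm_le_dotpp _) (xB k).
have Oxbar : Omega xbar.
  apply: Oclosed => U /nbhs_ballP[e e0 eU].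
  have [k _ xk] := xcluster e 0%N e0.
  by exists (x k); split => //; apply: eU; rewrite -ball_normE.
have solbar : solutions Omega f xbar.
  split=> // v Ov.
  have xbarw := sgp_cluster_value Oconv gcont fconv sgpx wsol xB Oxbar xcluster.
  by apply: (le_trans xbarw); have [_] := wsol; apply.
exists xbar => //; apply/cvgrPdist_lt => e e0.
have ee0 : 0 < e ^+ 2 / (2 * P) by rewrite divr_gt0 ?exprn_gt0// mulr_gt0.
(* One [h] is for the squared distance at [N], the other for the remaining decrease of [f];
   [P * (h + h)] is [e ^+ 2]. *)
set h := e ^+ 2 / (2 * P) in ee0.
have [N1 tail] : exists N, forall k, (N <= k)%N -> f (x N) - f (x k) < h / (C + 1).
  apply: (nonincreasing_tail (m := f w) fmono) => [k|].
    by have [_] := wsol; apply.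
  by rewrite divr_gt0// ltr_wpDl.
have n1 : 0 < n%:R + 1 :> R by rewrite ltr_wpDl.
(* The bound 1 makes the squared sup norm at most the norm itself; [n%:R + 1] avoids a zero
   denominator when [n] is 0. *)
have rho0 : 0 < Num.min 1 (h / (n%:R + 1)) by rewrite lt_min ltr01 divr_gt0.
have [N N1N] := xcluster _ N1 rho0; rewrite lt_min => /andP[xN1 xNh].
have aN : dotp (x N - xbar) (x N - xbar) <= h.
  apply: (le_trans (ler_norm _)); apply: (le_trans (normr_dotp_le _ _)).
  rewrite distrC; apply: (@le_trans _ _ ((n%:R + 1) * (h / (n%:R + 1)))).
    apply: ler_pM => //; first by rewrite lerDl.
    by rewrite -[leRHS]mul1r; apply: ler_pM => //; exact: ltW.
  by rewrite mulrC divfK// gt_eqF.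
exists N => // k /= Nk.
rewrite -(@ltr_pXn2r _ 2)// ?nnegrE// ?(ltW e0)// distrC.
apply: le_lt_trans (sqr_norm_le_dotpp _) _.
apply: le_lt_trans (fejer xbar solbar N k Nk) _.
have -> : e ^+ 2 = P * (h + h) by rewrite /h; field; rewrite gt_eqF.
rewrite ltr_pM2l// ler_ltD//.
apply: (@le_lt_trans _ _ (C * (h / (C + 1)))).
  rewrite ler_wpM2l// ltW// (le_lt_trans _ (tail k (leq_trans N1N Nk)))//.
  by rewrite lerB// fmono.
rewrite mulrCA gtr_pMr// ltr_pdivrMr ?ltr_wpDl// mul1r.
by rewrite ltrDl.
Qed.
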